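(* Let $G$ and $H$ be locally compact groups and let $\phi\colon G\to H$ be a morphism of locally compact groups. If $\phi(G_1)$ is open in $H$ for every open subgroup $G_1$ of $G$, then $\phi$ is an open mapping.
   Context: Locally compact groups are locally compact Hausdorff topological groups. A morphism of locally compact groups is a continuous group homomorphism between locally compact Hausdorff topological groups. A map is open if it sends open sets to open sets. *)

(* Defs.v *)
From HB Require Import structures.
From mathcomp Require Import all_boot.
From mathcomp Require Import boolp classical_sets topology.

Set Implicit Arguments.
Unset Strict Implicit.
Unset Printing Implicit Defensive.

Local Open Scope classical_set_scope.
Local Open Scope group_scope.

HB.structure Definition PreTopologicalGroup :=
  {G of Topological G & monoid.Group G}.

HB.mixin Record PreTopologicalGroup_isTopologicalGroup G
    & PreTopologicalGroup G := {
  mulg_continuous : continuous (fun x : (G * G)%type => x.1 * x.2) ;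
  invg_continuous : continuous (@monoid.inv G)
}.

#[short(type="topologicalGroupType")]
HB.structure Definition TopologicalGroup :=
  {G of PreTopologicalGroup G & PreTopologicalGroup_isTopologicalGroup G}.

HB.mixin Record TopologicalGroup_isLocallyCompactGroup G
    & TopologicalGroup G := {
  lcgroup_hausdorff : hausdorff_space G ;
  lcgroup_locally_compact : locally_compact [set: G]
}.

#[short(type="locallyCompactGroupType")]
HB.structure Definition LocallyCompactGroup :=
  {G of TopologicalGroup G & TopologicalGroup_isLocallyCompactGroup G}.

(* The library bundles group morphisms, see its factory isGroupMorphism, as
   maps preserving both the product and the unit. *)
#[short(type="topologicalGroupMorphism")]
HB.structure Definition TopologicalGroupMorphism
    (G H : topologicalGroupType) :=
  {f of @monoid.UMagmaMorphism G H f & isContinuous G H f}.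

Definition open_subgroup (G : topologicalGroupType) (A : set G) : Prop :=
  monoid.group_closed (mem A) /\ open A.

Definition open_mapping (X Y : topologicalType) (f : X -> Y) : Prop :=
  forall U : set X, open U -> open (f @` U).

(* Main.v *)
(* By translation it is enough that phi maps neighbourhoods of 1 to
   neighbourhoods of 1. A compact neighbourhood of 1 generates an open
   sigma-compact subgroup G1, which is covered by countably many translates of
   any compact neighbourhood W of 1. Hence the open set phi(G1) is covered by
   countably many translates of the compact set phi(W), and by the Baire
   category theorem in H the set phi(W) has an interior point; if W^-1 W is
   contained in U, then phi(U) is a neighbourhood of 1. *)

Require Import Defs.
From HB Require Import structures.
From mathcomp Require Import all_boot.
From mathcomp Require finmap.
From mathcomp Require Import boolp classical_sets topology.

Local Open Scope classical_set_scope.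

Lemma locally_compact_compact_nbhs (X : topologicalType) (x : X) :
  locally_compact [set: X] -> exists2 K, compact K & nbhs x K.
Proof.
move=> /(_ x I)[K]; rewrite withinET => xK [cK _].
by exists K.
Qed.

Lemma locally_compact_hausdorff_regular (X : topologicalType) :
  hausdorff_space X -> locally_compact [set: X] -> regular_space X.
Proof.
move=> hX lX x; have [K cK xK] := locally_compact_compact_nbhs X x lX.
exact: compact_regular hX cK xK.
Qed.

(** If every [F n] had empty interior, shrinking nonempty open sets could be chosen whose closures
    avoid each [F n] in turn. Started inside [O] and a compact neighbourhood, they would have a
    cluster point in [O] outside all [F n]. *)
Lemma locally_compact_Baire (X : topologicalType) (F : nat -> set X)
    (O : set X) :
  hausdorff_space X -> locally_compact [set: X] ->
  (forall n, closed (F n)) -> open O -> O !=set0 -> O `<=` \bigcup_n F n ->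
  exists n, (F n)° !=set0.
Proof.
move=> hX lX clF oO [x0 Ox0] OF; apply: contrapT => noint.
have regX := locally_compact_hausdorff_regular X hX lX.
(* A nonempty open U is not contained in F n, so by regularity U minus F n
   contains the closure of a nonempty open set. *)
have step (nU : nat * set X) : exists U', open nU.2 -> nU.2 !=set0 ->
    [/\ open U', U' !=set0 & closure U' `<=` nU.2 `\` F nU.1].
  case: nU => n U /=.
  (* If [U] is not open or is empty, the claim is vacuous and [set0] is a dummy value. *)
  have [oU|] := pselect (open U); last by exists set0.
  have [U0|] := pselect (U !=set0); last by exists set0.
  have [x [Ux Fx]] : (U `\` F n) !=set0.
    apply: contrapT => /nonemptyPn; rewrite setD_eq0 => UF.
    apply: noint; exists n; case: U0 => x Ux; exists x.
    by apply: (@filterS _ _ _ U) => //; exact: open_nbhs_nbhs.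
  have [N xN NU] : filter_from (nbhs x) closure (U `\` F n).
    apply: regX; apply: open_nbhs_nbhs; split=> //.
    by apply: openI => //; exact: closed_openC.
  exists N° => _ _; split; [exact: open_interior|by exists x|].
  by apply: subset_trans NU; apply: closureS; exact: interior_subset.
have [s sP] := choice step.
have [K cK xK] := locally_compact_compact_nbhs X x0 lX.
pose U := fix U n := if n is m.+1 then s (m, U m) else O `&` K°.
have UP n : open (U n) /\ U n !=set0.
  elim: n => [|n [oU U0]] /=.
    split; first by apply: openI => //; exact: open_interior.
    by exists x0.
  by have [] := sP (n, U n) oU U0.
have US n : closure (U n.+1) `<=` U n `\` F n.
  by have [oU U0] := UP n; have [] := sP (n, U n) oU U0.
have Umono m n : (m <= n)%N -> U n `<=` U m.
  elim: n => [|n IH]; first by rewrite leqn0 => /eqP->.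
  rewrite leq_eqVlt => /orP[/eqP-> //|/IH]; apply: subset_trans.
  by move=> y Uy; have [] := US n y (subset_closure Uy).
(* This filter contains [K], because [U 0] lies in [K], so compactness gives a cluster point [p]; it
   lies in the closure of every [U n.+1]. *)
pose FF := filter_from [set: nat] U.
have FFF : ProperFilter FF.
  apply: filter_from_proper => [|n _]; last by have [] := UP n.
  apply: filter_from_filter; first by exists 0%N.
  move=> i j _ _; exists (maxn i j) => // y Uy.
  by split; apply: Umono Uy; rewrite ?leq_maxl ?leq_maxr.
have [|p [_ clp]] := cK FF FFF.
  by exists 0%N => // y [_]; exact: interior_subset.
have pU n : (U n `\` F n) p.
  by apply: US => B pB; apply: clp => //; exists n.+1.
have [n _ Fp] : (\bigcup_n F n) p by apply: OF; have [[]] := pU 0%N.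
by have [] := pU n.
Qed.

Local Open Scope group_scope.

Lemma mulg_cvg (G : topologicalGroupType) (T : Type) (F : set_system T)
    (FF : Filter F) (f g : T -> G) (a b : G) :
  f @ F --> a -> g @ F --> b -> (fun t => f t * g t) @ F --> a * b.
Proof.
move=> fa gb; apply: (@cvg_comp _ _ _ (fun t => (f t, g t)) _ _ _ _ _
  (@mulg_continuous G (a, b))).
exact: cvg_pair.
Qed.

Lemma nbhs_lmulg (G : topologicalGroupType) (a x : G) (A : set G) :
  nbhs (a * x) A -> nbhs x [set y | A (a * y)].
Proof. by apply: (@mulg_cvg G G (nbhs x)); [exact: cvg_cst|exact: cvg_id]. Qed.

Lemma divg_continuous (G : topologicalGroupType) :
  continuous (fun p : G * G => p.1 / p.2).
Proof.
move=> p; apply: mulg_cvg; first exact: cvg_fst.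
by apply: (@cvg_comp _ _ _ snd monoid.inv); [exact: cvg_snd|exact: invg_continuous].
Qed.

Lemma nbhs1_divVg (G : topologicalGroupType) (U : set G) : nbhs 1 U ->
  exists2 V, nbhs 1 V & forall x y, V x -> V y -> U (x^-1 * y).
Proof.
move=> U1.
have : (fun p : G * G => p.1^-1 * p.2) @ nbhs (1 : G, 1 : G) --> (1 : G).
  rewrite -[X in _ --> X](_ : 1^-1 * 1 = 1 :> G); last by rewrite monoid.mulVg.
  apply: mulg_cvg; last exact: cvg_snd.
  by apply: (@cvg_comp _ _ _ fst monoid.inv); [exact: cvg_fst|exact: invg_continuous].
move=> /(_ U U1)[[A B] /= [A1 B1] AB].
by exists (A `&` B) => [|x y [Ax _] [_ By]]; [exact: filterI|exact: (AB (x, y))].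
Qed.

(** For x in [A], all y near x have x^-1 y in [A], and then y = x (x^-1 y) is in [A]. *)
Lemma open_subgroup_nbhs1 (G : topologicalGroupType) (A : set G) :
  monoid.group_closed (mem A) -> nbhs 1 A -> open_subgroup A.
Proof.
move=> gA A1; split=> //; rewrite openE => x Ax.
have : nbhs x [set y | A (x^-1 * y)].
  by apply: nbhs_lmulg; rewrite monoid.mulVg.
apply: filterS => y /= /mem_set Ay; apply: set_mem.
have /(_ _ _ (mem_set Ax) Ay) := monoid.group_closedM gA.
by rewrite monoid.mulVKg.
Qed.

(* When 1 is in K these sets increase, and their union is the subgroup
   generated by K. *)
Fixpoint iter_divg (G : topologicalGroupType) (K : set G) n : set G :=
  if n is m.+1 then
    (fun p : G * G => p.1 / p.2) @` (iter_divg G K m `*` iter_divg G K m)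
  else K.

Lemma compact_iter_divg (G : topologicalGroupType) (K : set G) n :
  compact K -> compact (iter_divg G K n).
Proof.
move=> cK; elim: n => //= n cn; apply: continuous_compact.
  exact/continuous_subspaceT/divg_continuous.
exact: compact_setX.
Qed.

Lemma iter_divg_open_subgroup (G : topologicalGroupType) (K : set G) :
  nbhs 1 K -> open_subgroup (\bigcup_n iter_divg G K n).
Proof.
move=> K1.
have d1 n : iter_divg G K n 1.
  elim: n => [|n IH] /=; first exact: nbhs_singleton.
  by exists (1, 1) => //=; rewrite monoid.divg1.
have mono m n : (m <= n)%N -> iter_divg G K m `<=` iter_divg G K n.
  elim: n => [|n IH]; first by rewrite leqn0 => /eqP->.
  rewrite leq_eqVlt => /orP[/eqP-> //|/IH mn] x /mn nx /=.
  by exists (x, 1) => //=; rewrite monoid.divg1.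
apply: open_subgroup_nbhs1; last by apply: filterS K1 => x Kx; exists 0%N.
split; first by apply/mem_set; exists 0%N.
move=> x y /set_mem[m _ mx] /set_mem[n _ ny]; apply/mem_set.
(* Both elements lie in level [maxn m n], hence their quotient lies in the next one. *)
exists (maxn m n).+1 => //=; exists (x, y) => //.
by split; [apply: mono mx; exact: leq_maxl|apply: mono ny; exact: leq_maxr].
Qed.

Lemma sigma_compact_lcosets (G : topologicalGroupType) (A : nat -> set G)
    (W : set G) :
  (forall n, compact (A n)) -> nbhs 1 W ->
  exists g : nat -> G, \bigcup_n A n `<=` \bigcup_n [set x | W ((g n)^-1 * x)].
Proof.
move=> cA W1.
have /choice[h hP] n :
    exists h : nat -> G, A n `<=` \bigcup_i [set x | W ((h i)^-1 * x)].
  (* compact_cover is only available for pointed spaces *)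
  pose Gp : ptopologicalType := HB.pack (TopologicalGroup.sort G) (isPointed.Build G 1).
  have : @compact Gp (A n) by exact: cA.
  rewrite compact_cover => /(_ G setT
    (fun g => [set x | W° (g^-1 * x)])) [].
  - move=> g _; rewrite openE => x Wx; apply: nbhs_lmulg.
    by apply: open_nbhs_nbhs; split=> //; exact: open_interior.
  - by move=> x _; exists x => //=; rewrite monoid.mulVg.
  (* The finite subcover is listed as a sequence; the default [1] past its end only adds one more
     translate, which is harmless. *)
  move=> D _ AD; exists (nth 1 (finmap.enum_fset D)) => x /AD[g /= gD Wx].
  by exists (index g (finmap.enum_fset D)) => //=; rewrite nth_index //; exact: interior_subset.
(* Coding pairs of indices turns the double sequence [h] into a single one; [1] fills the numbers
   that code no pair. *)
exists (fun k => if unpickle k is Some (i, j) then h i j else 1) => x [n _ Ax].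
by have [i _ Wx] := hP n x Ax; exists (pickle (n, i)) => //=; rewrite pickleK.
Qed.

Lemma nbhs1_image (G H : locallyCompactGroupType)
    (phi : topologicalGroupMorphism G H) (U : set G) :
  (forall G1 : set G, open_subgroup G1 -> open (phi @` G1)) ->
  nbhs 1 U -> nbhs 1 (phi @` U).
Proof.
move=> phiO U1.
have hH : hausdorff_space H := lcgroup_hausdorff.
have lG : locally_compact [set: G] := lcgroup_locally_compact.
have [V V1 VU] := nbhs1_divVg G U U1.
have [K cK K1] := locally_compact_compact_nbhs G 1 lG.
(* Taking [closure N] inside [V] makes [W] compact while x^-1 y stays in [U] for all x, y in [W]. *)
have [N N1 NV] := locally_compact_hausdorff_regular G lcgroup_hausdorff lG 1 V V1.
pose W := K `&` closure N.
have cW : compact W by apply: compact_closedI => //; exact: closed_closure.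
have W1 : nbhs 1 W by apply: filterI => //; apply: filterS N1; exact: subset_closure.
have sG := iter_divg_open_subgroup G K K1.
have [g gP] := sigma_compact_lcosets G (iter_divg G K) W
  (fun n => compact_iter_divg G K n cK) W1.
have phic : continuous phi by move=> x; exact: cts_fun.
(* This is the translate of phi(W) by phi(g n), written as a preimage so that it inherits closedness
   from phi(W). *)
pose F n := [set y | (phi @` W) ((phi (g n))^-1 * y)].
have clW : closed (phi @` W).
  apply: compact_closed => //; apply: continuous_compact => //.
  exact: continuous_subspaceT.
have [||||n [y yF]] := locally_compact_Baire H F (phi @` \bigcup_n iter_divg G K n)
    hH lcgroup_locally_compact.
- move=> n; apply: closed_comp clW => y _.
  by apply: mulg_cvg; [exact: cvg_cst|exact: cvg_id].
- exact: phiO.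
- by exists (phi 1), 1 => //; case: sG => -[/set_mem].
- move=> _ [x /gP[n _ Wx] <-]; exists n => //.
  by exists ((g n)^-1 * x) => //; rewrite monoid.gmulfM monoid.gmulfV.
(* Here phi(w) = phi(g n)^-1 y, and for z near 1 some v in [W] has phi(v) = phi(g n)^-1 y z; hence
   phi(w^-1 v) = z. *)
have [w [_ Nw] wy] := nbhs_singleton yF.
have : nbhs 1 [set z | F n (y * z)] by apply: nbhs_lmulg; rewrite monoid.mulg1.
apply: filterS => z [v [_ Nv] vz]; exists (w^-1 * v).
  by apply: VU; exact: NV.
have -> : phi (w^-1 * v) = (phi w)^-1 * phi v.
  by rewrite monoid.gmulfM monoid.gmulfV.
by rewrite wy vz (monoid.mulgA _ y) monoid.mulKg.
Qed.

Theorem theorem2 (G H : locallyCompactGroupType)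
    (phi : topologicalGroupMorphism G H) :
  (forall G1 : set G, open_subgroup G1 -> open (phi @` G1)) ->
  open_mapping phi.
Proof.
move=> phiO U oU; rewrite openE => _ [x Ux <-].
(* The translate x^-1 U is a neighbourhood of 1; its image is then moved back by phi(x). *)
have Ux1 : nbhs 1 [set y | U (x * y)].
  by apply: nbhs_lmulg; rewrite monoid.mulg1; exact: open_nbhs_nbhs.
have phiU := nbhs1_image G H phi _ phiO Ux1.
have : nbhs (phi x) [set y | (phi @` [set y | U (x * y)]) ((phi x)^-1 * y)].
  by apply: nbhs_lmulg; rewrite monoid.mulVg.
apply: filterS => y [z Uz zy]; exists (x * z) => //.
have -> : phi (x * z) = phi x * phi z by exact: monoid.gmulfM.
by rewrite zy monoid.mulVKg.
Qed.
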